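(* Let $\mathbb{M}$ be a monoid, $A$ a nonempty set, $\Lambda\subset A^{\mathbb{M}}$ a shift space, and let $\mathbf{1}\in\{0,1\}^{\mathbb{M}}$ be the configuration with value $1$ at every site of $\mathbb{M}$. Then $\Lambda$ is a shift of finite type if and only if there exists a sliding block code $\Phi:A^{\mathbb{M}}\to\{0,1\}^{\mathbb{M}}$ such that $\Lambda=\Phi^{-1}(\mathbf{1})$.
   Context: $\mathbb{M}$ is a monoid written multiplicatively with identity $1$. For $x=(x_i)_{i\in\mathbb{M}}\in A^{\mathbb{M}}$ and $g\in\mathbb{M}$, $\sigma^g(x)=(x_{gi})_{i\in\mathbb{M}}$. A pattern is an element of $A^N$ with $N\subset\mathbb{M}$ finite nonempty. For a set $F$ of patterns, $X_F:=\{x\in A^{\mathbb{M}}: (x_{gi})_{i\in N}\notin F\ \forall g\in\mathbb{M},\ \forall N\subset\mathbb{M}\text{ finite nonempty}\}$; shift spaces are the sets of the form $X_F$. $M_F:=\{g\in\mathbb{M}:\ \exists N\subset\mathbb{M},\ g\in N,\ A^N\cap F\neq\emptyset\}$ is the set of indices used in patterns of $F$. The alphabet $A$ may be infinite. $\Lambda$ is a shift of finite type (SFT) if $\Lambda=X_F$ for some set of patterns $F$ with $M_F$ finite. For a shift space $\Lambda\subset A^{\mathbb{M}}$ and finite $M\subset\mathbb{M}$, $W_M(\Lambda):=\{(x_i)_{i\in M}: x\in\Lambda\}$. A map $\Phi:\Lambda\to B^{\mathbb{M}}$ is a sliding block code (SBC) if there are a finite set $M\subset\mathbb{M}$ and a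 map $\phi:W_M(\Lambda)\to B$ with $(\Phi(x))_g=\phi\big((x_{gi})_{i\in M}\big)$ for all $x\in\Lambda$, $g\in\mathbb{M}$. *)

(* Defs.v *)
From mathcomp Require Import all_boot finmap.
From mathcomp Require Import boolp classical_sets functions cardinality.

Set Implicit Arguments.
Unset Strict Implicit.
Unset Printing Implicit Defensive.

Local Open Scope group_scope.
Local Open Scope fset_scope.
Local Open Scope classical_set_scope.

(* The configuration space A^M is the function type M -> A; M is written
   multiplicatively. An element of A^N, for N a finite subset of M, is a finite
   map of type {fmap M -> A} whose domain is N. *)

Definition shift (M : monoidType) (A : Type) (g : M) (x : M -> A) : M -> A :=
  fun i => x (g * i).

Definition restr (M : monoidType) (A : Type) (N : {fset M}) (x : M -> A) :
    {fmap M -> A} :=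
  [fmap i : N => x (val i)].

Definition power (M : monoidType) (A : Type) (N : {fset M}) :
    set {fmap M -> A} :=
  [set p | domf p = N].

Definition patterns (M : monoidType) (A : Type) : set {fmap M -> A} :=
  \bigcup_(N in [set N : {fset M} | N != fset0]) power N.

Definition avoiding (M : monoidType) (A : Type) (F : set {fmap M -> A}) :
    set (M -> A) :=
  [set x | forall (g : M) (N : {fset M}),
     N != fset0 -> ~ F (restr N (shift g x))].

Definition indices (M : monoidType) (A : Type) (F : set {fmap M -> A}) :
    set M :=
  [set g | exists2 N : {fset M}, g \in N & power N `&` F !=set0].

Definition shift_space (M : monoidType) (A : Type) (L : set (M -> A)) : Prop :=
  exists2 F : set {fmap M -> A}, F `<=` @patterns M A & L = avoiding F.

Lemma shift_space_shift (M : monoidType) (A : Type) (L : set (M -> A))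
    (g : M) (x : M -> A) :
  shift_space L -> L x -> L (shift g x).
Proof.
case=> F _ -> Lx h N N0.
suff -> : shift h (shift g x) = shift (g * h) x by exact: Lx.
by apply/funext => i; rewrite /shift mulgA.
Qed.

Definition sft (M : monoidType) (A : Type) (L : set (M -> A)) : Prop :=
  exists F : set {fmap M -> A},
    [/\ F `<=` @patterns M A, finite_set (indices F) & L = avoiding F].

Definition blocks (M : monoidType) (A : Type) (N : {fset M})
    (L : set (M -> A)) : set {fmap M -> A} :=
  [set restr N x | x in L].

(* A map L -> B^M is given by a total function of which only the values on L
   matter. The local rule phi is defined on blocks N L only, so its argument w
   is the block (x_(g i))_(i in N) together with its membership in
   blocks N L; for a shift space L such a w always exists, by
   shift_space_shift. *)
Definition sliding_block_code (M : monoidType) (A B : Type) (L : set (M -> A))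
    (Phi : (M -> A) -> (M -> B)) : Prop :=
  exists (N : {fset M}) (phi : blocks N L -> B),
    forall (x : M -> A) (g : M), L x ->
      exists2 w : blocks N L,
        val w = restr N (shift g x) & Phi x g = phi w.

(* Main.v *)
(* A sliding block code on the full shift is x, g |-> f (shift g x) for some f
   reading finitely many coordinates. If L = X_F with finitely many indices, take
   for f the indicator of "no pattern of F occurs in x at the identity"; f reads
   only the indices of F, even though F itself may be infinite. Conversely,
   forbid the window patterns on which f vanishes. *)

Require Import Defs.
From mathcomp Require Import all_boot finmap.
From mathcomp Require Import boolp classical_sets functions cardinality.

Local Open Scope classical_set_scope.

Lemma fnd_restr {M : monoidType} {A : Type} (N : {fset M}) (x : M -> A) (i : M) :
  fnd (restr N x) i = if i \in N then Some (x i) else None.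
Proof.
case: ifP => iN; last by apply: not_fnd; rewrite iN.
by rewrite (in_fnd (f := restr N x) iN) ffunE.
Qed.

Lemma restr_eqP {M : monoidType} {A : Type} {N : {fset M}} {x y : M -> A} :
  restr N x = restr N y <-> {in N, x =1 y}.
Proof.
split=> [E i iN|E].
  by have := congr1 (fun f : {fmap M -> A} => fnd f i) E; rewrite !fnd_restr iN => -[].
by apply/fmapP => i; rewrite !fnd_restr; case: ifP => // /E ->.
Qed.

Lemma shift1 {M : monoidType} {A : Type} (x : M -> A) : shift 1%g x = x.
Proof. by apply/funext => i; rewrite /shift mul1g. Qed.

Definition local_at {M : monoidType} {A B : Type} (N : {fset M})
    (f : (M -> A) -> B) : Prop :=
  forall x y, {in N, x =1 y} -> f x = f y.

(** [Phi x g] and [Phi (shift g x) 1] apply [phi] to the same block, so [f] can be taken to be [Phi]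
    read at the identity. A rule on configurations carries no membership proof in [blocks]. *)
Lemma sliding_block_codeP {M : monoidType} {A B : Type}
    (Phi : (M -> A) -> (M -> B)) :
  sliding_block_code [set: M -> A] Phi <->
  exists (N : {fset M}) (f : (M -> A) -> B),
    local_at N f /\ forall x g, Phi x g = f (shift g x).
Proof.
split=> [[N [phi PhiE]]|[N [f [floc PhiE]]]].
  exists N, (fun x => Phi x 1%g); split=> [x y xy|x g].
    have [w wx ->] := PhiE x 1%g I; have [v vy ->] := PhiE y 1%g I.
    congr phi; apply: val_inj; rewrite wx vy !shift1.
    exact/restr_eqP.
  have [w wx ->] := PhiE x g I.
  have [v vx ->] := PhiE (shift g x) 1%g I.
  by congr phi; apply: val_inj; rewrite wx vx shift1.
have ext (w : blocks N [set: M -> A]) : exists x, restr N x = val w.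
  by case: w => w /=; rewrite inE => -[x _ <-]; exists x.
(* A block is evaluated on an arbitrarily chosen configuration extending it; locality of [f] makes
   the choice irrelevant. *)
exists N, (fun w => f (projT1 (cid (ext w)))) => x g _.
have wP : restr N (shift g x) \in blocks N [set: M -> A].
  by rewrite inE; exists (shift g x).
exists (SigSub wP) => //.
rewrite PhiE; case: cid => y /= /restr_eqP yx.
by apply/esym/floc.
Qed.

Lemma sft_sliding_block_code {M : monoidType} {A : Type} (L : set (M -> A)) :
  sft L ->
  exists2 Phi : (M -> A) -> (M -> bool),
    sliding_block_code [set: M -> A] Phi &
    L = Phi @^-1` [set (fun _ : M => true)].
Proof.
case=> F [_ /finite_fsetP[N NF] ->].
pose f (x : M -> A) :=
  `[< forall K : {fset M}, K != fset0 -> ~ F (restr K x) >].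
exists (fun x g => f (shift g x)).
  apply/sliding_block_codeP; exists N, f; split=> // x y xy.
  suff sub u v : {in N, u =1 v} -> f u -> f v.
    by apply/idP/idP; apply: sub => // i /xy.
  move=> uv /asboolP fu; apply/asboolP => K K0 FKv.
  (* The support of a pattern of [F] consists of indices of [F], so [K] lies in [N], where [u] and
     [v] agree. *)
  apply: (fu K K0); suff -> : restr K u = restr K v by [].
  apply/restr_eqP => i iK; apply: uv.
  suff : indices F i by rewrite NF.
  by exists K => //; exists (restr K v).
apply/seteqP; split=> x.
  by move=> Lx; apply/funext => g; apply/asboolP => K; exact: Lx.
by move=> /= fx g; apply/asboolP; rewrite -/(f (shift g x)) (congr1 (@^~ g) fx).
Qed.

Lemma sliding_block_code_sft {M : monoidType} {A : Type}
    (Phi : (M -> A) -> (M -> bool)) :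
  sliding_block_code [set: M -> A] Phi ->
  sft (Phi @^-1` [set (fun _ : M => true)]).
Proof.
case/sliding_block_codeP => N [f [floc PhiE]].
(* [N] may be empty, whereas patterns have nonempty support. *)
pose K : {fset M} := (1%g |` N)%fset.
have K0 : K != fset0 by apply/fset0Pn; exists 1%g; rewrite fset1U1.
exists [set restr K x | x in [set x | ~~ f x]]; split.
- by move=> _ [x _ <-]; exists K.
(* All forbidden patterns have the same domain [K]. *)
- apply: (@sub_finite_set _ _ [set` K]); last exact: finite_fset.
  by move=> g [H gH [p [/= pH [x _ xp]]]] /=; move: pH gH; rewrite -xp => <-.
apply/seteqP; split=> x.
  move=> /= Phix g H _ [y fy E].
  (* Equal finite maps have equal domains. Hence [y] and [shift g x] agree on [K], so on [N], and
     [f y] equals [Phi x g], which is true, against the choice of [y]. *)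
  have KH : K = H by have := congr1 (@domf _ _) E.
  move: fy; rewrite /= (floc y (shift g x)) -?PhiE ?Phix // => i iN.
  by move: E; rewrite -KH => /restr_eqP; apply; rewrite fset1Ur.
move=> Fx; apply/funext => g; rewrite PhiE.
by apply: contrapT => /negP fN; apply: (Fx g K K0); exists (shift g x).
Qed.

Theorem theorem5p5 (M : monoidType) (A : Type) (hA : inhabited A)
    (L : set (M -> A)) (hL : shift_space L) :
  sft L <->
  exists2 Phi : (M -> A) -> (M -> bool),
    sliding_block_code [set: M -> A] Phi &
    L = Phi @^-1` [set (fun _ : M => true)].
Proof.
split; first exact: sft_sliding_block_code.
by case=> Phi PhiP ->; exact: sliding_block_code_sft.
Qed.
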